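(* Let $D$ be a non-trivial strongly connected digraph. (a) The following are equivalent: (i) $D=\overleftrightarrow{K}_n$ for some $n\ge 2$; (ii) $\mathrm{diam}(D)=1$; (iii) $\overrightarrow{srvc}(D)=0$; (iv) $\overrightarrow{rvc}(D)=0$; (v) $\overrightarrow{src}(D)=1$; (vi) $\overrightarrow{rc}(D)=1$. (b) (i) $\overrightarrow{srvc}(D)=1$ if and only if $\overrightarrow{rvc}(D)=1$, if and only if $\mathrm{diam}(D)=2$. (ii) $\overrightarrow{srvc}(D)=2$ if and only if $\overrightarrow{rvc}(D)=2$. (iii) $\overrightarrow{src}(D)=2$ if and only if $\overrightarrow{rc}(D)=2$. Moreover, either of the conditions in (b)(iii) implies each of the conditions in (b)(i).
   Context: All digraphs are finite and simple; non-trivial means at least two vertices. A (directed) path is a sequence of distinct vertices $x_0,\dots,x_\ell$ with each $x_{i-1}x_i$ an arc; its length is $\ell$. A digraph is strongly connected if for every ordered pair $(u,v)$ there is a $u$–$v$ path; $d(u,v)$ is the length of a shortest $u$–$v$ path (a $u$–$v$ geodesic), and $\mathrm{diam}(D)=\max d(u,v)$. $\overleftrightarrow{K}_n$ is the complete digraph on $n$ vertices (all ordered pairs of distinct vertices are arcs). In a vertex-coloured digraph, a path is (vertex-)rainbow if its internal vertices have pairwise distinct colours; in an arc-coloured digraph, a path is rainbow if its arcs have pairwise distinct colours. A vertex-colouring of $D$ is rainbow vertex-connected if every ordered pair $(u,v)$ is joined by a rainbow $u$–$v$ path, and strongly rainbow vertex-connected if every ordered pair is joined by a rainbow $u$–$v$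 geodesic; $\overrightarrow{rvc}(D)$, $\overrightarrow{srvc}(D)$ denote the minimum numbers of colours in such colourings (taken to be $0$ when no internal vertices ever need colouring, i.e. when every ordered pair of distinct vertices is an arc). Analogously, an arc-colouring is rainbow connected (resp. strongly rainbow connected) if every ordered pair $(u,v)$ is joined by an arc-rainbow $u$–$v$ path (resp. geodesic); $\overrightarrow{rc}(D)$, $\overrightarrow{src}(D)$ are the minimum numbers of colours in such arc-colourings. *)

(* Defs.v *)
From mathcomp Require Import all_boot.
From mathcomp Require Import boolp classical_sets.

Set Implicit Arguments.
Unset Strict Implicit.
Unset Printing Implicit Defensive.

(* Loopless and without parallel arcs; a pair of opposite arcs is allowed. *)
Record digraph := Digraph {
  vertex :> finType;
  arc : rel vertex;
  arc_irrefl : irreflexive arc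
}.

(* Junk value 0 on the empty set. *)
Definition least (A : set nat) : nat :=
  xget 0 [set n | A n /\ forall m, A m -> n <= m]%classic.

Lemma complete_irrefl n : irreflexive (fun i j : 'I_n => i != j).
Proof. by move=> i; rewrite eqxx. Qed.

Definition complete_digraph (n : nat) : digraph := Digraph (@complete_irrefl n).

Definition isomorphic (D H : digraph) : Prop :=
  exists f : D -> H, bijective f /\ forall u v, arc (f u) (f v) = arc u v.

Section Digraph.
Variable D : digraph.
Implicit Types (u v : D) (p : seq D).

(* The path x_0, ..., x_l is encoded by u = x_0 and p = [:: x_1; ...; x_l],
   so that its length l is size p. *)
Definition dipath u v p : bool :=
  [&& path (@arc D) u p, last u p == v & uniq (u :: p)].

Definition strongly_connected : Prop := forall u v, exists p, dipath u v p.

Definition dist u v : nat :=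
  least [set l | exists2 p, dipath u v p & size p = l]%classic.

Definition geodesic u v p : bool := dipath u v p && (size p == dist u v).

Definition diam : nat := \max_(u : D) \max_(v : D) dist u v.

(* x_1, ..., x_(l-1) *)
Definition internal u p : seq D := behead (belast u p).

Definition arc_of : Type := {a : D * D | arc a.1 a.2}.

(* (x_0, x_1), ..., (x_(l-1), x_l); on a path, insub drops nothing. *)
Definition arcs u p : seq arc_of := pmap insub (zip (u :: p) p).

Definition vertex_rainbow k (c : D -> 'I_k) u p : bool :=
  uniq (map c (internal u p)).

Definition arc_rainbow k (c : arc_of -> 'I_k) u p : bool :=
  uniq (map c (arcs u p)).

Definition rainbow_vertex_connected k (c : D -> 'I_k) : Prop :=
  forall u v, exists2 p, dipath u v p & vertex_rainbow c u p.

Definition strongly_rainbow_vertex_connected k (c : D -> 'I_k) : Prop :=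
  forall u v, exists2 p, geodesic u v p & vertex_rainbow c u p.

Definition rainbow_connected k (c : arc_of -> 'I_k) : Prop :=
  forall u v, exists2 p, dipath u v p & arc_rainbow c u p.

Definition strongly_rainbow_connected k (c : arc_of -> 'I_k) : Prop :=
  forall u v, exists2 p, geodesic u v p & arc_rainbow c u p.

Definition all_arcs : bool := [forall u : D, forall v : D, (u != v) ==> arc u v].

(* The vertex parameters are 0 by convention when no internal vertex ever needs
   a colour; a colouring of all the vertices always uses at least one. *)
Definition rvc : nat :=
  if all_arcs then 0
  else least [set k | exists c : D -> 'I_k, rainbow_vertex_connected c]%classic.

Definition srvc : nat :=
  if all_arcs then 0
  else least
    [set k | exists c : D -> 'I_k, strongly_rainbow_vertex_connected c]%classic.

Definition rc : nat :=
  least [set k | exists c : arc_of -> 'I_k, rainbow_connected c]%classic.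

Definition src : nat :=
  least [set k | exists c : arc_of -> 'I_k, strongly_rainbow_connected c]%classic.

End Digraph.

(* Main.v *)
(* A rainbow path that uses at most two colours is so short (at most 2 arcs, or
   at most 2 internal vertices) that either it is a geodesic or every geodesic
   with the same ends has at most one arc, resp. internal vertex, and is thus
   rainbow. Hence with at most two colours the rainbow and the strongly rainbow
   parameters agree, and the first values of each parameter are read off the
   lengths of the paths. *)
From mathcomp Require Import all_boot.
From mathcomp Require Import boolp classical_sets.
Require Import Defs.

Set Implicit Arguments.
Unset Strict Implicit.
Unset Printing Implicit Defensive.

(** * Minima of sets of naturals, and sequences of distinct colours *)

Lemma leastP (A : set nat) n : A n -> A (least A) /\ least A <= n.
Proof.
move=> An.
have exA : exists m, `[< A m >] by exists n; apply/asboolP.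
have [m /asboolP Am m_min] := ex_minnP exA.
have Pm : [set m | A m /\ forall i, A i -> m <= i]%classic m.
  by split=> // i Ai; apply/m_min/asboolP.
(* Since a minimum [m] exists, [xget] picks a minimum and not its default 0. *)
have [Al l_min] : A (least A) /\ forall i, A i -> least A <= i.
  exact: (xgetPex 0 (ex_intro _ m Pm)).
by split=> //; exact: l_min.
Qed.

Lemma sub_least (A B : set nat) n :
  (A `<=` B)%classic -> A n -> least B <= least A.
Proof. by move=> sAB /leastP[Al _]; have [] := leastP (sAB _ Al). Qed.

(** Pigeonhole: this turns a number of colours into a bound on the length of a rainbow path. *)
Lemma uniq_map_size (T : Type) k (c : T -> 'I_k) s :
  uniq (map c s) -> size s <= k.
Proof.
by move/card_uniqP; rewrite size_map => <-; rewrite -[leqRHS]card_ord max_card.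
Qed.

Lemma uniq_short (T : eqType) (s : seq T) : size s <= 1 -> uniq s.
Proof. by case: s => [|x []]. Qed.

(** * Paths, geodesics and distances *)

Section Digraph.
Variable D : digraph.
Implicit Types (u v : D) (p : seq D).

Lemma size_internal u p : size (internal u p) = (size p).-1.
Proof. by rewrite size_behead size_belast. Qed.

Lemma internal_uniq u v p : dipath u v p -> uniq (internal u p).
Proof.
case/and3P=> _ _; rewrite lastI rcons_uniq => /andP[_].
by rewrite /internal; case: (belast u p) => //= x s /andP[].
Qed.

Lemma size_arcs u p : path (@arc D) u p -> size (arcs u p) = size p.
Proof.
rewrite /arcs; elim: p u => //= v p IHp u /andP[uv vp].
by rewrite (@insubT _ (fun a : D * D => arc a.1 a.2) _ (u, v) uv) /= IHp.
Qed.

Lemma arcs_uniq u v p : dipath u v p -> uniq (arcs u p).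
Proof.
case/and3P=> _ _ /= /andP[_ p_uniq]; apply: pmap_sub_uniq.
(* The heads of the arcs are the entries of [p], which are pairwise distinct. *)
apply: (@map_uniq _ _ snd); rewrite -/(unzip2 _) unzip2_zip //=.
Qed.

Lemma dipath_arc u v : u != v -> arc u v -> dipath u v [:: v].
Proof. by move=> nuv uv; rewrite /dipath /= uv eqxx inE nuv. Qed.

Lemma dipath_size0 u v p : u != v -> dipath u v p -> 0 < size p.
Proof. by case: p => // nuv /and3P[_ /=]; rewrite (negPf nuv). Qed.

Lemma dipath_size1 u v p : u != v -> dipath u v p -> size p <= 1 -> arc u v.
Proof.
move=> nuv; case: p => [/and3P[_ /=]|w [] //]; first by rewrite (negPf nuv).
by case/and3P=> /=; rewrite andbT => uw /eqP<-.
Qed.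

Lemma dist_le u v p : dipath u v p -> dist u v <= size p.
Proof.
move=> uvp.
have uvn : [set l | exists2 q, dipath u v q & size q = l]%classic (size p).
  by exists p.
by have [] := leastP uvn.
Qed.

Lemma geodesic_of_size u v p :
  dipath u v p -> size p <= dist u v -> geodesic u v p.
Proof. by move=> uvp le_p; rewrite /geodesic uvp eqn_leq le_p dist_le. Qed.

Lemma dist_le_diam u v : dist u v <= diam D.
Proof.
apply: leq_trans (leq_bigmax u).
exact: (leq_bigmax (F := fun v => dist u v)).
Qed.

Lemma diam_le k : (forall u v, dist u v <= k) -> diam D <= k.
Proof. by move=> le_k; apply/bigmax_leqP=> u _; apply/bigmax_leqP. Qed.

(** * Distance bounds from rainbow colourings *)

Lemma strongly_rvcW k (c : D -> 'I_k) :
  strongly_rainbow_vertex_connected c -> rainbow_vertex_connected c.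
Proof. by move=> cP u v; have [p /andP[uvp _]] := cP u v; exists p. Qed.

Lemma strongly_rcW k (c : arc_of D -> 'I_k) :
  strongly_rainbow_connected c -> rainbow_connected c.
Proof. by move=> cP u v; have [p /andP[uvp _]] := cP u v; exists p. Qed.

Lemma rvc_dist k (c : D -> 'I_k) u v :
  rainbow_vertex_connected c -> dist u v <= k.+1.
Proof.
case/(_ u v)=> p /dist_le le_p /uniq_map_size; rewrite size_internal => p_le.
(* A path with l > 0 arcs has l - 1 internal vertices, whence the bound [k.+1]. *)
by rewrite (leq_trans le_p) // -ltnS; case: (size p) p_le.
Qed.

Lemma rc_dist k (c : arc_of D -> 'I_k) u v :
  rainbow_connected c -> dist u v <= k.
Proof.
case/(_ u v)=> p uvp /uniq_map_size; have /and3P[u_p _ _] := uvp.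
by rewrite size_arcs //; exact/leq_trans/dist_le.
Qed.

(** * Strong connectivity: optimal colourings exist, and two colours suffice to make them strong *)

Hypothesis D_strong : strongly_connected D.

Lemma geodesic_ex u v : exists p, geodesic u v p.
Proof.
have [q uvq] := D_strong u v.
have uvn : [set l | exists2 p, dipath u v p & size p = l]%classic (size q).
  by exists q.
have [[p uvp sz_p] _] := leastP uvn.
by exists p; rewrite /geodesic uvp sz_p eqxx.
Qed.

Lemma strongly_rvc_small k (c : D -> 'I_k) :
  k <= 2 -> rainbow_vertex_connected c -> strongly_rainbow_vertex_connected c.
Proof.
move=> k2 cP u v; have [p uvp c_p] := cP u v.
have p3 : (size p).-1 <= 2.
  by rewrite -(size_internal u); apply: leq_trans k2; exact: uniq_map_size c_p.
have [le_p|lt_p] := leqP (size p) (dist u v).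
  by exists p => //; exact: geodesic_of_size.
have [q uvq] := geodesic_ex u v; exists q => //.
apply: uniq_short; rewrite size_map size_internal.
have /andP[_ /eqP->] := uvq.
(* Here [dist u v < size p <= 3], so a geodesic has at most two arcs and one internal vertex. *)
by case: (dist u v) (size p) lt_p p3 => [|[|[|d]]] [|[|[|[|n]]]].
Qed.

Lemma strongly_rc_small k (c : arc_of D -> 'I_k) :
  k <= 2 -> rainbow_connected c -> strongly_rainbow_connected c.
Proof.
move=> k2 cP u v; have [p uvp c_p] := cP u v.
have p2 : size p <= 2.
  have /and3P[u_p _ _] := uvp.
  by rewrite -(size_arcs u_p); apply: leq_trans k2; exact: uniq_map_size c_p.
have [le_p|lt_p] := leqP (size p) (dist u v).
  by exists p => //; exact: geodesic_of_size.
have [q uvq] := geodesic_ex u v; exists q => //.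
have /andP[/and3P[u_q _ _] /eqP sz_q] := uvq.
apply: uniq_short; rewrite size_map size_arcs // sz_q.
by rewrite -ltnS (leq_trans lt_p).
Qed.

(** An injective colouring makes every geodesic rainbow. This gives [least] a non-empty set, so that
    the vertex parameters are true minima. *)
Lemma srvc_colouring_ex :
  exists c : D -> 'I_#|D|, strongly_rainbow_vertex_connected c.
Proof.
exists enum_rank => u v; have [p uvp] := geodesic_ex u v; exists p => //.
rewrite /vertex_rainbow map_inj_uniq; last exact: enum_rank_inj.
by have /andP[/internal_uniq] := uvp.
Qed.

Lemma src_colouring_ex :
  exists c : arc_of D -> 'I_#|{: {a : D * D | arc a.1 a.2}}|,
    strongly_rainbow_connected c.
Proof.
exists enum_rank => u v; have [p uvp] := geodesic_ex u v; exists p => //.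
rewrite /arc_rainbow map_inj_uniq; last exact: enum_rank_inj.
by have /andP[/arcs_uniq] := uvp.
Qed.

(** Complete digraphs are set apart because [rvc D] is 0 there by convention, and a vertex has no
    colour in ['I_0]. *)
Lemma rvc_colouring : ~~ all_arcs D ->
  exists c : D -> 'I_(rvc D), rainbow_vertex_connected c.
Proof.
move=> /negPf nD; rewrite /rvc nD.
have [c /strongly_rvcW cP] := srvc_colouring_ex.
by have [] := @leastP
  [set k | exists c : D -> 'I_k, rainbow_vertex_connected c]%classic
  _ (ex_intro _ c cP).
Qed.

Lemma rc_colouring : exists c : arc_of D -> 'I_(rc D), rainbow_connected c.
Proof.
have [c /strongly_rcW cP] := src_colouring_ex.
by have [] := @leastP
  [set k | exists c : arc_of D -> 'I_k, rainbow_connected c]%classic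
  _ (ex_intro _ c cP).
Qed.

Lemma srvc_le k (c : D -> 'I_k) :
  strongly_rainbow_vertex_connected c -> srvc D <= k.
Proof.
rewrite /srvc; case: ifP => // _ cP.
by have [] := @leastP
  [set k | exists c : D -> 'I_k, strongly_rainbow_vertex_connected c]%classic
  _ (ex_intro _ c cP).
Qed.

Lemma src_le k (c : arc_of D -> 'I_k) :
  strongly_rainbow_connected c -> src D <= k.
Proof.
move=> cP; by have [] := @leastP
  [set k | exists c : arc_of D -> 'I_k, strongly_rainbow_connected c]%classic
  _ (ex_intro _ c cP).
Qed.

Lemma rvc_le_srvc : rvc D <= srvc D.
Proof.
rewrite /rvc /srvc; case: ifP => // _.
apply: sub_least (srvc_colouring_ex) => k [c /strongly_rvcW cP].
by exists c.
Qed.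

Lemma rc_le_src : rc D <= src D.
Proof.
apply: sub_least (src_colouring_ex) => k [c /strongly_rcW cP].
by exists c.
Qed.

Lemma srvc_eq_rvc : rvc D <= 2 -> srvc D = rvc D.
Proof.
move=> rvc2; apply/eqP; rewrite eqn_leq rvc_le_srvc andbT.
have [aD|/rvc_colouring[c cP]] := boolP (all_arcs D).
  by rewrite /srvc aD.
exact/(srvc_le (strongly_rvc_small rvc2 cP)).
Qed.

Lemma src_eq_rc : rc D <= 2 -> src D = rc D.
Proof.
move=> rc2; apply/eqP; rewrite eqn_leq rc_le_src andbT.
have [c cP] := rc_colouring; exact/(src_le (strongly_rc_small rc2 cP)).
Qed.

(** * Non-trivial digraphs: the first values of the parameters *)

Hypothesis D_nontrivial : 2 <= #|vertex D|.

Lemma distinct_pair : exists u v : D, u != v.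
Proof. by have /card_gt1P[u [v [_ _ nuv]]] := D_nontrivial; exists u, v. Qed.

(** This form of completeness is the one that links it to [diam D] and to [rc D]. The bound is an
    inequality because [u = v] is allowed, with the empty path. *)
Lemma all_arcs_dist : all_arcs D <-> forall u v, dist u v <= 1.
Proof.
split=> [/forallP aD u v | d1].
  have [<-|nuv] := eqVneq u v.
    by apply: leq_trans (@dist_le u u [::] _) _; rewrite // /dipath /= eqxx.
  have /forallP/(_ v)/implyP/(_ nuv) := aD u.
  by move/(dipath_arc nuv)/dist_le.
apply/forallP=> u; apply/forallP=> v; apply/implyP=> nuv.
have [p /andP[uvp /eqP sz_p]] := geodesic_ex u v.
by apply: (dipath_size1 nuv uvp); rewrite sz_p.
Qed.

Lemma diam_gt0 : 0 < diam D.
Proof.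
have [u [v nuv]] := distinct_pair.
apply: leq_trans (dist_le_diam u v).
have [p /andP[uvp /eqP<-]] := geodesic_ex u v; exact: dipath_size0 uvp.
Qed.

Lemma diam_eq1 : diam D = 1 <-> all_arcs D.
Proof.
split=> [d1|/all_arcs_dist/diam_le d1].
  by apply/all_arcs_dist=> u v; rewrite -d1 dist_le_diam.
by apply/eqP; rewrite eqn_leq d1 diam_gt0.
Qed.

Lemma rvc_eq0 : rvc D = 0 <-> all_arcs D.
Proof.
split=> [r0|aD]; last by rewrite /rvc aD.
apply/negPn/negP=> /rvc_colouring[c _].
(* The colour of [u] would lie in the empty type ['I_0]. *)
by have [u _] := distinct_pair; have := ltn_ord (c u); rewrite {2}r0.
Qed.

Lemma rvc_le1 : rvc D <= 1 <-> diam D <= 2.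
Proof.
have [aD|nD] := boolP (all_arcs D).
  by rewrite /rvc aD (diam_eq1.2 aD).
split=> [r1|d2].
  have [c cP] := rvc_colouring nD; apply: diam_le => u v.
  exact: leq_trans (rvc_dist u v cP) _.
(* With diameter at most 2 a geodesic has at most one internal vertex, so a constant colouring is
   strongly rainbow. *)
apply: leq_trans rvc_le_srvc _; apply: (@srvc_le 1 (fun=> ord0)) => u v.
have [p uvp] := geodesic_ex u v; exists p => //.
apply: uniq_short; rewrite size_map size_internal.
have /andP[_ /eqP->] := uvp; have := leq_trans (dist_le_diam u v) d2.
by case: (dist u v).
Qed.

(** From [rvc_le1] remove the complete case, which is [rvc D = 0] on one side and [diam D = 1] on
    the other; [diam D = 0] is excluded. *)
Lemma rvc_eq1 : rvc D = 1 <-> diam D = 2.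
Proof.
have := diam_gt0; have := diam_eq1; have := rvc_eq0; have := rvc_le1.
case: (rvc D) (diam D) => [|[|r]] [|[|[|d]]] //=; intuition discriminate.
Qed.

Lemma rc_gt0 : 0 < rc D.
Proof.
have [u [v nuv]] := distinct_pair; have [c cP] := rc_colouring.
have [p uvp _] := cP u v; have /and3P[/size_arcs sz_p _ _] := uvp.
have := dipath_size0 nuv uvp; rewrite -sz_p.
(* The path has some arc [a], and its colour is an element of ['I_(rc D)]. *)
by case: (arcs u p) => // a _ _; exact: leq_ltn_trans (ltn_ord (c a)).
Qed.

Lemma rc_eq1 : rc D = 1 <-> all_arcs D.
Proof.
split=> [r1|/all_arcs_dist d1].
  have [c cP] := rc_colouring; apply/all_arcs_dist=> u v.
  by rewrite -r1; exact: rc_dist cP.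
apply/eqP; rewrite eqn_leq rc_gt0 andbT; apply: leq_trans rc_le_src _.
(* Every geodesic has at most one arc, so a single colour is enough. *)
apply: (@src_le 1 (fun=> ord0)) => u v.
have [p uvp] := geodesic_ex u v; exists p => //.
have /andP[/and3P[u_p _ _] /eqP sz_p] := uvp.
by apply: uniq_short; rewrite size_map size_arcs // sz_p.
Qed.

Lemma all_arcs_isomorphic :
  all_arcs D <-> exists n, 2 <= n /\ isomorphic D (complete_digraph n).
Proof.
split=> [/forallP aD|[n [_ [f [/bij_inj f_inj fP]]]]].
  (* Any bijection from a complete digraph to an ordinal preserves arcs and non-arcs; [enum_rank] is
     one. *)
  exists #|vertex D|; split=> //; exists enum_rank; split.
    exact: enum_rank_bij.
  move=> u v /=; rewrite (inj_eq enum_rank_inj).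
  have [->|nuv] := eqVneq u v; first by rewrite arc_irrefl.
  by have /forallP/(_ v)/implyP/(_ nuv)-> := aD u.
apply/forallP=> u; apply/forallP=> v; apply/implyP=> nuv.
by rewrite -fP /= (inj_eq f_inj).
Qed.

(** Two arc colours bound all distances by 2, while diameter 1 would mean completeness and so
    [rc D = 1]. *)
Lemma rc_eq2_diam : rc D = 2 -> diam D = 2.
Proof.
move=> r2; have d2 : diam D <= 2.
  have [c cP] := rc_colouring; apply: diam_le => u v.
  by rewrite -r2; exact: rc_dist cP.
have d1 : diam D != 1.
  by apply/eqP=> /diam_eq1/rc_eq1; rewrite r2.
by apply/eqP; rewrite eqn_leq d2 ltn_neqAle eq_sym d1 diam_gt0.
Qed.

Lemma srvc_small k : k <= 2 -> srvc D = k <-> rvc D = k.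
Proof.
move=> k2; split=> [sk|rk]; last by rewrite srvc_eq_rvc ?rk.
(* A small [srvc D] forces a small [rvc D], which is what [srvc_eq_rvc] requires. *)
by rewrite -srvc_eq_rvc // (leq_trans rvc_le_srvc) // sk.
Qed.

Lemma src_small k : k <= 2 -> src D = k <-> rc D = k.
Proof.
move=> k2; split=> [sk|rk]; last by rewrite src_eq_rc ?rk.
by rewrite -src_eq_rc // (leq_trans rc_le_src) // sk.
Qed.

End Digraph.

Theorem theorem2 (D : digraph) (D_nontrivial : 2 <= #|vertex D|)
    (D_strong : strongly_connected D) :
  [<-> exists n : nat, 2 <= n /\ isomorphic D (complete_digraph n);
       diam D = 1;
       srvc D = 0;
       rvc D = 0;
       src D = 1;
       rc D = 1] /\
  [/\ [<-> srvc D = 1; rvc D = 1; diam D = 2],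
      (srvc D = 2 <-> rvc D = 2),
      (src D = 2 <-> rc D = 2) &
      (src D = 2 \/ rc D = 2 -> [/\ srvc D = 1, rvc D = 1 & diam D = 2])].
Proof.
have sv k := srvc_small D_strong (k := k).
have sa k := src_small D_strong (k := k).
have iso := all_arcs_isomorphic D_nontrivial.
have d1 := diam_eq1 D_strong D_nontrivial.
have v0 := rvc_eq0 D_strong D_nontrivial.
have v1 := rvc_eq1 D_strong D_nontrivial.
have r1 := rc_eq1 D_strong D_nontrivial.
split.
  (* The cycle of implications passes through [all_arcs D]; the steps between strong and plain
     parameters use that the values are at most 2. *)
  tfae.
  - by move/iso/d1.
  - by move/d1/v0/sv; apply.
  - by move/sv; apply.
  - by move/v0/r1/sa; apply.
  - by move/sa; apply.
  - by move/r1/iso.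
split; [|exact: sv|exact: sa|].
  tfae.
  - by move/sv; apply.
  - by move/v1.
  - by move/v1/sv; apply.
move=> src2; have d2 : diam D = 2.
  (* Either alternative gives [rc D = 2]. *)
  apply: rc_eq2_diam => //; case: src2 => // /sa; exact.
by split=> //; [apply/sv => //; exact/v1 | exact/v1].
Qed.
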